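(* Let $K_p,K_d,K_i\in\mathbb{R}^{m\times p}$ be such that the closed loop of the system $$\dot x(t)=A_0x(t)+\sum_{k=1}^{K}A_kx(t-\tau_k)+Bu(t),\qquad y(t)=Cx(t),$$ with the PID control law $$u(t)=K_p\,y(t)+K_d\,\dot y(t)+K_i\int_0^t y(s)\,ds$$ is exponentially stable. If the spectral radius of $BK_dC$ is larger than one, then for every $r>0$ the closed loop of the input-delayed system $$\dot x(t)=A_0x(t)+\sum_{k=1}^{K}A_kx(t-\tau_k)+Bu(t-r),\qquad y(t)=Cx(t),$$ with the same PID control law is unstable.
   Context: Data: $x(t)\in\mathbb{R}^n$, $u(t)\in\mathbb{R}^m$, $y(t)\in\mathbb{R}^p$; discrete delays $0<\tau_1<\dots<\tau_K<+\infty$; real matrices $A_0,\dots,A_K\in\mathbb{R}^{n\times n}$, $B\in\mathbb{R}^{n\times m}$ of full column rank, $C\in\mathbb{R}^{p\times n}$ of full row rank. Let $q=\operatorname{rank}(K_i)$ and $K_i=U_iV_i$ with $U_i\in\mathbb{R}^{m\times q}$ of full column rank and $V_i\in\mathbb{R}^{q\times p}$ of full row rank (blocks of size $q$ are absent if $q=0$). Characteristic function of the nominal closed loop (no input delay): $$H_0(\lambda)=\det\left(\lambda\begin{bmatrix}I_n-BK_dC&0\\0&I_q\end{bmatrix}-\begin{bmatrix}A_0+BK_pC&BU_i\\ V_iC&0\end{bmatrix}-\sum_{k=1}^{K}\begin{bmatrix}A_k&0\\0&0\end{bmatrix}e^{-\lambda\tau_k}\right).$$ Characteristic function of the closed loop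 with input delay $r$: $$H_1(\lambda;r)=\det\left(\lambda\left(\begin{bmatrix}I_n&0\\0&I_q\end{bmatrix}-\begin{bmatrix}BK_dC&0\\0&0\end{bmatrix}e^{-\lambda r}\right)-\begin{bmatrix}A_0&0\\ V_iC&0\end{bmatrix}-\begin{bmatrix}BK_pC&BU_i\\0&0\end{bmatrix}e^{-\lambda r}-\sum_{k=1}^{K}\begin{bmatrix}A_k&0\\0&0\end{bmatrix}e^{-\lambda\tau_k}\right).$$ A closed loop is exponentially stable if and only if all roots of its characteristic function lie in the open left half-plane, bounded away from the imaginary axis (i.e. there is $c>0$ such that all roots satisfy $\Re(\lambda)\le -c$). It is unstable if its characteristic function has at least one root in the open right half-plane. *)

(* Defs.v *)
From HB Require Import structures.
From mathcomp Require Import all_boot all_order all_algebra.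
From mathcomp Require Import classical_sets reals sequences exp trigo.
From mathcomp Require Import complex.

Set Implicit Arguments.
Unset Strict Implicit.
Unset Printing Implicit Defensive.

Import Order.TTheory GRing.Theory Num.Theory.
Local Open Scope classical_set_scope.
Local Open Scope ring_scope.
Local Open Scope complex_scope.

Definition cexp {R : realType} (z : R[i]) : R[i] :=
  let: a +i* b := z in (expR a * cos b) +i* (expR a * sin b).

Definition cplx_mx {R : realType} {m n : nat} (M : 'M[R]_(m, n)) :
    'M[R[i]]_(m, n) :=
  map_mx (real_complex R) M.

(* The eigenvalues of a real matrix are taken in R[i]; [complex.Re `|mu|] is
   the modulus of [mu] as a real number.  For n > 0 the set is finite and
   nonempty, so the supremum is a maximum; for n = 0 it is empty and the
   spectral radius is 0. *)
Definition spectral_radius {R : realType} {n : nat} (M : 'M[R]_n) : R :=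
  sup [set complex.Re `|mu| | mu in [set mu | eigenvalue (cplx_mx M) mu]].

(* Delay k + 1 of the plant, in 1-based numbering, is [tau k], and the matrix
   multiplying the state with that delay is [A k].  The gain of the integral
   action enters through a factorization [Ui *m Vi]; the last q coordinates of
   the closed loop are those of the integrator. *)
Definition nominal_charfun {R : realType} {n m p K q : nat}
    (A0 : 'M[R]_n) (A : 'I_K -> 'M[R]_n) (tau : 'I_K -> R)
    (B : 'M[R]_(n, m)) (C : 'M[R]_(p, n)) (Kp Kd : 'M[R]_(m, p))
    (Ui : 'M[R]_(m, q)) (Vi : 'M[R]_(q, p)) (lambda : R[i]) : R[i] :=
  \det (lambda *: cplx_mx (block_mx (1%:M - B *m Kd *m C) 0 0 1%:M)
        - cplx_mx (block_mx (A0 + B *m Kp *m C) (B *m Ui) (Vi *m C) 0)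
        - \sum_(k < K)
            cexp (- lambda * (tau k)%:C) *: cplx_mx (block_mx (A k) 0 0 0)
        : 'M[R[i]]_(n + q)).

Definition input_delay_charfun {R : realType} {n m p K q : nat}
    (A0 : 'M[R]_n) (A : 'I_K -> 'M[R]_n) (tau : 'I_K -> R)
    (B : 'M[R]_(n, m)) (C : 'M[R]_(p, n)) (Kp Kd : 'M[R]_(m, p))
    (Ui : 'M[R]_(m, q)) (Vi : 'M[R]_(q, p)) (r : R) (lambda : R[i]) : R[i] :=
  \det (lambda *: (cplx_mx (block_mx 1%:M 0 0 1%:M)
                   - cexp (- lambda * r%:C) *:
                       cplx_mx (block_mx (B *m Kd *m C) 0 0 0))
        - cplx_mx (block_mx A0 0 (Vi *m C) 0)
        - cexp (- lambda * r%:C) *: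
            cplx_mx (block_mx (B *m Kp *m C) (B *m Ui) 0 0)
        - \sum_(k < K)
            cexp (- lambda * (tau k)%:C) *: cplx_mx (block_mx (A k) 0 0 0)
        : 'M[R[i]]_(n + q)).

(* Stability and instability of a closed loop, in terms of its characteristic
   function [H].  Instability is not the negation of exponential stability. *)
Definition exponentially_stable {R : realType} (H : R[i] -> R[i]) : Prop :=
  exists2 c : R, 0 < c &
    forall lambda : R[i], H lambda = 0 -> complex.Re lambda <= - c.

Definition unstable {R : realType} (H : R[i] -> R[i]) : Prop :=
  exists2 lambda : R[i], H lambda = 0 & 0 < complex.Re lambda.

(* Main.v *)
Require Import Defs.
From mathcomp Require Import all_boot all_order all_algebra.
From mathcomp Require Import perm.
From mathcomp Require Import reals complex.
From mathcomp Require Import ring lra.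
From mathcomp Require Import boolp classical_sets topology normedtype derive.
From mathcomp Require Import sequences exp trigo.

Set Implicit Arguments.
Unset Strict Implicit.
Unset Printing Implicit Defensive.

Import Order.TTheory GRing.Theory Num.Theory numFieldNormedType.Exports.
Import Normc.
Local Open Scope ring_scope.

(** Only the neutral part of the closed loop matters.  Write the characteristic
    matrix as [lambda *: N lambda - E lambda], where
    [N lambda = 1 - e^(- lambda r) D], [D] is [B Kd C] bordered by zeros and [E]
    is bounded on the right half-plane.  An eigenvalue [mu] of [B Kd C] of
    modulus larger than one gives a zero [lambda0] of [det N], namely a
    logarithm of [mu] divided by [r], whose real part [ln |mu| / r] is positive
    ([neutral_root]).  As [N] is periodic with the imaginary period [2 i pi / r],
    all the points [lambda0 + 2 i pi k / r] are zeros of [det N].  There the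
    matrix [N lambda - E lambda / lambda] is arbitrarily close to [N lambda] when
    [k] is large, so that by Hurwitz's principle its determinant vanishes near
    [lambda0 + 2 i pi k / r], still in the open right half-plane
    ([large_modulus_zero]).

    Hurwitz's principle is derived from a maximum modulus principle on squares
    ([max_modulus_square]), which is proved without contour integrals.  If [h]
    had at the centre of a square a modulus larger than on the boundary, then
    [|h|^2 + eps |z|^2] with a small [eps > 0] would have an interior maximum.
    This is excluded by averaging over the four points [z + s i^j]: in a Taylor
    expansion of order three of [h] at [z] the linear and quadratic terms cancel
    from the average of [|h|^2] except for nonnegative contributions, so that
    the average exceeds the central value by at least [eps s^2 - O(s^3)]
    ([no_strict_local_max]).  Applied to [1 / f] this yields a zero of [f] in
    every square on whose boundary [|f|] stays above its value at the centre
    ([zero_in_square]).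

    The only regularity required is therefore a Taylor expansion of order three
    at every point.  Such expansions are stable under the ring operations and
    inversion, hence under determinants, and the complex exponential has one by
    the Taylor estimates of [expR], [cos] and [sin]. *)

(** * Finite Taylor expansions *)

Section Jets.
Local Open Scope classical_set_scope.
Local Open Scope ring_scope.
Variable F : numFieldType.
Implicit Types (f g : F -> F) (k : nat).

(** [jet k f] says that [f w = a_0 + a_1 w + ... + a_(k-1) w^(k-1) + O(w^k)] as
    [w] tends to 0.  Peeling off one coefficient at a time turns the stability
    properties below into short inductions on [k]. *)
Fixpoint jet k f : Prop :=
  if k is k'.+1 then
    exists a g, jet k' g /\ \forall w \near (0 : F), f w = a + w * g w
  else exists M : F, \forall w \near (0 : F), `|f w| <= M.

(** Unlike plain case analysis, this view keeps the remainder's [jet] folded. *)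
Lemma jetSP k f : jet k.+1 f ->
  exists a g, jet k g /\ \forall w \near (0 : F), f w = a + w * g w.
Proof. by []. Qed.

Lemma jet_near k f g : (\forall w \near (0 : F), f w = g w) -> jet k f -> jet k g.
Proof.
case: k => [|k] fg /=.
  move=> [M fM]; exists M; near=> w.
  by rewrite -(near fg w) //; near: w.
move=> /jetSP[a [h [hk fh]]]; exists a, h; split=> //; near=> w.
by rewrite -(near fg w) //; near: w.
Unshelve. all: by end_near. Qed.

Lemma jet_ext k f g : f =1 g -> jet k f -> jet k g.
Proof. by move=> fg; apply: jet_near; near=> w; exact: fg.
Unshelve. all: by end_near. Qed.

Lemma jetS k a f g : (forall w, f w = a + w * g w) -> jet k g -> jet k.+1 f.
Proof. by move=> fE gk; exists a, g; split=> //; near=> w.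
Unshelve. all: by end_near. Qed.

Lemma jet0_bound f M : (forall w, `|w| <= 1 -> `|f w| <= M) -> jet 0 f.
Proof.
move=> fM; exists M; near=> w; apply: fM; near: w; exact: (@nbhs0_le F F).
Unshelve. all: by end_near. Qed.

Lemma jet_cst k (c : F) : jet k (fun=> c).
Proof.
elim: k c => [|k IH] c; first by exists `|c|; near=> w.
by apply: jetS (IH 0) => w; rewrite mulr0 addr0.
Unshelve. all: by end_near. Qed.

Lemma jet_pred k f : jet k.+1 f -> jet k f.
Proof.
elim: k f => [|k IH] f /jetSP[a [g [gk fE]]]; last first.
  by exists a, g; split=> //; exact: (IH _ gk).
case: gk => M gM; exists (`|a| + M); near=> w.
rewrite (near fE w) //.
apply: le_trans (ler_normD _ _) _; rewrite lerD2l normrM.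
rewrite -[leRHS]mul1r ler_pM //.
by near: w.
Unshelve. all: by end_near. Qed.

Lemma jetD k f g : jet k f -> jet k g -> jet k (fun w => f w + g w).
Proof.
elim: k f g => [|k IH] f g.
  move=> [M fM] [N gN]; exists (M + N); near=> w.
  by apply: le_trans (ler_normD _ _) (lerD _ _); near: w.
move=> /jetSP[a [f' [f'k fE]]] /jetSP[b [g' [g'k gE]]].
exists (a + b), (fun w => f' w + g' w); split; first exact: IH.
near=> w; rewrite (near fE w) //.
by rewrite (near gE w) //; ring.
Unshelve. all: by end_near. Qed.

Lemma jetM k f g : jet k f -> jet k g -> jet k (fun w => f w * g w).
Proof.
elim: k f g => [|k IH] f g.
  move=> [M fM] [N gN]; exists (M * N); near=> w.
  by rewrite normrM ler_pM //; near: w.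
move=> fk gk; have fk' := jet_pred fk.
case/jetSP: fk gk => [a [f' [f'k fE]]] /jetSP[b [g' [g'k gE]]].
exists (a * b), (fun w => f' w * b + f w * g' w); split.
  by apply: jetD; [apply: IH (jet_cst _ _) | exact: IH].
near=> w; rewrite (near gE w) //.
by rewrite (near fE w) //; ring.
Unshelve. all: by end_near. Qed.

Lemma jet_id k : jet k (id : F -> F).
Proof.
apply: jet_pred; apply: (@jetS _ 0 _ (fun=> 1)) (jet_cst _ _) => w.
by rewrite add0r mulr1.
Qed.

Lemma jet_sum k (I : Type) (r : seq I) (P : pred I) (f : I -> F -> F) :
  (forall i, jet k (f i)) -> jet k (fun w => \sum_(i <- r | P i) f i w).
Proof.
move=> fk; elim: r => [|i r IH].
  by apply: jet_ext (jet_cst k 0) => w; rewrite big_nil.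
case Pi: (P i); last by apply: jet_ext IH => w; rewrite big_cons Pi.
by apply: jet_ext (jetD (fk i) IH) => w; rewrite big_cons Pi.
Qed.

Lemma jet_prod k (I : Type) (r : seq I) (P : pred I) (f : I -> F -> F) :
  (forall i, jet k (f i)) -> jet k (fun w => \prod_(i <- r | P i) f i w).
Proof.
move=> fk; elim: r => [|i r IH].
  by apply: jet_ext (jet_cst k 1) => w; rewrite big_nil.
case Pi: (P i); last by apply: jet_ext IH => w; rewrite big_cons Pi.
by apply: jet_ext (jetM (fk i) IH) => w; rewrite big_cons Pi.
Qed.

Lemma jet_det k n (M : F -> 'M[F]_n) :
  (forall i j, jet k (fun w => M w i j)) -> jet k (fun w => \det (M w)).
Proof.
move=> Mk; apply: jet_sum => s; apply: jetM; first exact: jet_cst.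
by apply: jet_prod => i; exact: Mk.
Qed.

Lemma near0_scale (c : F) (P : F -> Prop) :
  (\forall w \near (0 : F), P w) -> \forall w \near (0 : F), P (c * w).
Proof.
move=> nP; have /(_ P) := @mulrl_continuous F c 0.
by rewrite mulr0; apply.
Qed.

Lemma jet_scale k c f : jet k f -> jet k (fun w => f (c * w)).
Proof.
elim: k f => [|k IH] f.
  by move=> [M fM]; exists M; exact: near0_scale fM.
move=> /jetSP[a [g [gk fE]]]; exists a, (fun w => c * g (c * w)); split.
  by apply: jetM (IH _ gk); exact: jet_cst.
have := near0_scale c fE; apply: filterS => w ->; ring.
Qed.

(** An expansion of positive order entails continuity at 0. *)
Lemma jet1_near k f (e : F) : jet k.+1 f -> 0 < e ->
  \forall w \near (0 : F), `|f w - f 0| < e.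
Proof.
move=> fk e_gt0; have {fk}: jet 1 f.
  by elim: k f fk => // k IH f /jet_pred; exact: IH.
move=> [a [g [[M gM] fE]]].
have f0 : f 0 = a by rewrite (nbhs_singleton fE) mul0r addr0.
have M0 : 0 <= M := le_trans (normr_ge0 _) (nbhs_singleton gM).
have M1 : 0 < M + 1 by rewrite ltr_wpDl.
near=> w; rewrite f0 (near fE w) //.
rewrite addrAC subrr add0r normrM.
apply: le_lt_trans (_ : `|w| * (M + 1) < _).
  rewrite ler_wpM2l // (@le_trans _ _ M) ?lerDl //; by near: w.
rewrite -ltr_pdivlMr //; near: w; by apply: (@nbhs0_lt F F); exact: divr_gt0.
Unshelve. all: by end_near. Qed.

(** From [f w = a + w g w] one gets [1 / f = 1 / a - w (g / f) / a], so that an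
    expansion of [1 / f] gains one order as long as [g] has that order; the
    starting point is that [1 / f] is bounded where [|f|] exceeds half of
    [|f 0|]. *)
Lemma jet_inv k f : jet k.+1 f -> f 0 != 0 -> jet k.+1 (fun w => (f w)^-1).
Proof.
move=> fk f0.
have f_gt : \forall w \near (0 : F), `|f 0| / 2 < `|f w|.
  have e0 : 0 < `|f 0| / 2 by rewrite divr_gt0 ?normr_gt0.
  near=> w.
  have lt_e : `|f w - f 0| < `|f 0| / 2 by near: w; exact: (@jet1_near k).
  rewrite -(ltrD2r (`|f 0| / 2)) -splitr.
  apply: le_lt_trans (_ : `|f w| + `|f w - f 0| < _); last by rewrite ltrD2l.
  by rewrite -[X in `|X| <= _](subKr (f w)) ler_normB.
have step j : jet j.+1 f -> jet j (fun w => (f w)^-1) -> jet j.+1 (fun w => (f w)^-1).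
  move=> /jetSP[a [g [gj fE]]] fj.
  have fa : f 0 = a by rewrite (nbhs_singleton fE) mul0r addr0.
  exists a^-1, (fun w => - a^-1 * (g w * (f w)^-1)); split.
    by apply: jetM (jet_cst _ _) (jetM _ fj).
  near=> w; have fw : f w != 0.
    rewrite -normr_gt0 (@le_lt_trans _ _ (`|f 0| / 2)) ?divr_ge0 //.
    by near: w.
  have -> : w * (- a^-1 * (g w * (f w)^-1)) = - a^-1 * ((w * g w) / f w) by ring.
  have -> : w * g w = f w - a.
    by rewrite (near fE w) //; ring.
  by field; rewrite fw -fa.
have bd : jet 0 (fun w => (f w)^-1).
  exists ((`|f 0| / 2)^-1); near=> w; rewrite normrV ?unitfE.
    rewrite lef_pV2 ?posrE ?divr_gt0 ?normr_gt0 //; first by apply/ltW; near: w.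
    rewrite -normr_gt0 (@le_lt_trans _ _ (`|f 0| / 2)) ?divr_ge0 //.
    by near: w.
  rewrite -normr_gt0 (@le_lt_trans _ _ (`|f 0| / 2)) ?divr_ge0 //.
  by near: w.
elim: k fk => [|k IH] fk; apply: step => //.
by apply: IH; exact: jet_pred.
Unshelve. all: by end_near. Qed.

End Jets.

(** * The complex exponential *)

Section Cexp.
Variable R : realType.
Local Open Scope complex_scope.
Implicit Types (x y a b : R) (z w : R[i]).

(** The mean value theorem raises the order of a bound by one; iterating it
    gives the Taylor estimates of [expR], [cos] and [sin]. *)
Lemma deriv_bound (g dg : R -> R) (k : nat) (M : R) :
  (forall x, is_derive x 1 g (dg x)) -> g 0 = 0 -> 0 <= M ->
  (forall x, `|x| <= 1 -> `|dg x| <= M * `|x| ^+ k) ->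
  forall x, `|x| <= 1 -> `|g x| <= M * `|x| ^+ k.+1.
Proof.
move=> gd g0 M0 dgM x x1.
have gc : continuous g.
  by move=> y; apply: differentiable_continuous; apply/derivable1_diffP.
have [c cx gE] : exists2 c, `|c| <= `|x| & g x = dg c * x.
  have [x0|x0] := leP 0 x.
    have [c] := MVT_segment x0 (fun y _ => gd y) (continuous_subspaceT gc).
    rewrite in_itv /= => /andP[c0 cx]; rewrite g0 !subr0 => ->; exists c => //.
    by rewrite !ger0_norm.
  have [c] := MVT_segment (ltW x0) (fun y _ => gd y) (continuous_subspaceT gc).
  rewrite in_itv /= => /andP[xc c0]; rewrite g0 !sub0r mulrN => /oppr_inj ->.
  by exists c => //; rewrite !ler0_norm ?lerN2 // ltW.
rewrite gE normrM exprSr mulrA ler_wpM2r //.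
apply: le_trans (dgM _ (le_trans cx x1)) _.
by rewrite ler_wpM2l // lerXn2r ?nnegrE.
Qed.

Lemma expR_taylor2 x : `|x| <= 1 ->
  `|expR x - (1 + x + x ^+ 2 / 2)| <= expR 1 * `|x| ^+ 3.
Proof.
have e0 : 0 <= expR 1 :> R by exact: expR_ge0.
apply: (@deriv_bound (fun x => expR x - (1 + x + x ^+ 2 / 2))
                    (fun x => expR x - (1 + x))) => //.
- by move=> y; apply: is_derive_eq; rewrite /GRing.scale /=; field.
- by rewrite expR0; ring.
apply: (@deriv_bound (fun x => expR x - (1 + x)) (fun x => expR x - 1)) => //.
- by move=> y; apply: is_derive_eq; ring.
- by rewrite expR0; ring.
apply: (@deriv_bound (fun x => expR x - 1) expR) => //.
- by move=> y; apply: is_derive_eq; ring.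
- by rewrite expR0; ring.
move=> y y1; rewrite expr0 mulr1 ger0_norm ?expR_ge0 // ler_expR.
by apply: le_trans y1; exact: ler_norm.
Qed.

Lemma cos_taylor1 x : `|x| <= 1 -> `|cos x - 1| <= `|x| ^+ 2.
Proof.
rewrite -[X in _ -> _ <= X]mul1r; move: x.
apply: (@deriv_bound (fun x => cos x - 1) (fun x => - sin x)) => //.
- by move=> y; apply: is_derive_eq; ring.
- by rewrite cos0 subrr.
move=> x; rewrite normrN; move: x.
apply: (@deriv_bound sin cos) => //; first exact: sin0.
by move=> x _; rewrite mul1r cos_max.
Qed.

Lemma sin_taylor2 x : `|x| <= 1 -> `|sin x - x| <= `|x| ^+ 3.
Proof.
rewrite -[X in _ -> _ <= X]mul1r; move: x.
apply: (@deriv_bound (fun x => sin x - x) (fun x => cos x - 1)) => //.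
- by rewrite sin0 subrr.
by move=> y y1; rewrite mul1r cos_taylor1.
Qed.

Lemma cos_taylor2 x : `|x| <= 1 -> `|cos x - (1 - x ^+ 2 / 2)| <= `|x| ^+ 3.
Proof.
move=> x1; apply: (@le_trans _ _ (1 * `|x| ^+ 4)); last first.
  by rewrite mul1r exprS ler_piMl ?exprn_ge0.
move: x x1.
apply: (@deriv_bound (fun x => cos x - (1 - x ^+ 2 / 2)) (fun x => - (sin x - x))) => //.
- by move=> y; apply: is_derive_eq; rewrite /GRing.scale /=; field.
- by rewrite cos0; ring.
by move=> y y1; rewrite mul1r normrN sin_taylor2.
Qed.

Lemma normc_ge_Im z : (`|complex.Im z|)%:C <= `|z|.
Proof.
case: z => a b; rewrite normc_def lecR /= -sqrtr_sqr ler_wsqrtr //.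
by rewrite lerDr sqr_ge0.
Qed.

Lemma normc_le_ReIm z : `|z| <= (`|complex.Re z| + `|complex.Im z|)%:C.
Proof.
case: z => a b; rewrite normc_def lecR /= -[leRHS]ger0_norm ?addr_ge0 //.
rewrite -sqrtr_sqr ler_wsqrtr // sqrrD !real_normK ?num_real //.
by rewrite lerD2r lerDl mulrn_wge0 ?mulr_ge0.
Qed.

Lemma cexpD z w : cexp (z + w) = cexp z * cexp w.
Proof.
case: z w => [a b] [c d]; rewrite /cexp /= expRD cosD sinD.
by apply/eqP; rewrite eq_complex /=; apply/andP; split; apply/eqP; ring.
Qed.

Lemma cexp0 : cexp 0 = 1 :> R[i].
Proof. by rewrite /cexp /= expR0 cos0 sin0 mulr0 mulr1. Qed.

Lemma normc_cexp z : `|cexp z| = (expR (complex.Re z))%:C.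
Proof.
case: z => a b; rewrite normc_def /=; congr (_%:C).
rewrite !exprMn -mulrDr cos2Dsin2 mulr1 sqrtr_sqr ger0_norm //.
exact: expR_ge0.
Qed.

(** With [w = a + i b], the product of the expansions of [expR a] and of
    [cos b + i sin b] agrees with [1 + w + w^2 / 2] up to terms of total degree
    at least three in [a] and [b]. *)
Lemma cexp_taylor2 : exists M : R[i], forall w, `|w| <= 1 ->
  `|cexp w - (1 + w + w ^+ 2 / 2)| <= M * `|w| ^+ 3.
Proof.
exists (2 * (expR 1 + 5))%:C => w w1.
have [t wt] : exists t, `|w| = t%:C.
  by exists (complex.Re `|w|); rewrite normc_def.
have t1 : t <= 1 by move: w1; rewrite wt lecR.
have := normc_ge_Im w; have := normc_ge_Re w.
rewrite {}wt !lecR -rmorphXn -rmorphM /=.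
case: w {w1} => a b /= {}at_ bt.
have t0 : 0 <= t := le_trans (normr_ge0 _) at_.
have a1 := le_trans at_ t1; have b1 := le_trans bt t1.
apply: le_trans (normc_le_ReIm _) _; rewrite lecR.
have -> : (2^-1 : R[i]) = (2^-1 : R)%:C by rewrite fmorphV rmorph_nat.
have := expR_taylor2 a1; have := sin_taylor2 b1.
have := cos_taylor2 b1.
have : `|sin b| <= 1 by exact: sin_max.
have : `|cos b| <= 1 by exact: cos_max.
rewrite /cexp /=.
have pw (x : R) : `|x| <= t -> `|x| ^+ 3 <= t ^+ 3.
  by move=> xt; rewrite lerXn2r ?nnegrE.
move=> c1 s1 /le_trans/(_ (pw _ bt)) hc /le_trans/(_ (pw _ bt)) hs he.
have {}he : `|expR a - (1 + a + a ^+ 2 / 2)| <= expR 1 * t ^+ 3.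
  by apply: le_trans he _; rewrite ler_wpM2l ?expR_ge0 // pw.
move: (expR a) (cos b) (sin b) (expR 1) c1 s1 hc hs he (expR_ge0 (1 : R)).
move=> E c s e c1 s1 hc hs he e0.
set P := 1 + a + a ^+ 2 / 2 in he.
have t3 : 0 <= t ^+ 3 by rewrite exprn_ge0.
have normP : `|P| <= 5 / 2.
  by rewrite /P; move: a1; rewrite !ler_norml => /andP[? ?]; nra.
have mono u v x y : `|u| <= x -> `|v| <= y -> `|u * v| <= x * y.
  by move=> ux vy; rewrite normrM ler_pM.
have ah : `|a + a ^+ 2 / 2| <= 3 / 2 * t.
  apply: le_trans (ler_normD _ _) _; rewrite normrM normrX normfV normr_nat.
  have := normr_ge0 a; nra.
have bh : `|b ^+ 2 / 2| <= t ^+ 2 / 2.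
  rewrite normrM normrX normfV normr_nat; have := normr_ge0 b; nra.
have aah : `|a ^+ 2 / 2| <= t ^+ 2 / 2.
  rewrite normrM normrX normfV normr_nat; have := normr_ge0 a; nra.
have h1 := mono _ _ _ _ he c1; have h2 := mono _ _ _ _ normP hc.
have h3 := mono _ _ _ _ ah bh; have h4 := mono _ _ _ _ he s1.
have h5 := mono _ _ _ _ normP hs; have h6 := mono _ _ _ _ aah bt.
(* The real part contributes the first three terms, the imaginary part the
   last three. *)
apply: (@le_trans _ _ ((e * t ^+ 3 * 1 + 5 / 2 * t ^+ 3 + 3 / 2 * t * (t ^+ 2 / 2))
   + (e * t ^+ 3 * 1 + 5 / 2 * t ^+ 3 + t ^+ 2 / 2 * t))); last first.
  by rewrite -subr_ge0; move: t3; rewrite !exprS expr0; nra.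
apply: lerD.
  apply: le_trans (lerD (lerD h1 h2) h3).
  apply: le_trans (lerD (ler_normD _ _) (lexx _)).
  apply: le_trans (ler_normB _ _).
  rewrite le_eqVlt; apply/orP; left; apply/eqP; congr `|_|.
  by rewrite /P !expr2 /=; field.
apply: le_trans (lerD (lerD h4 h5) h6).
apply: le_trans (lerD (ler_normD _ _) (lexx _)).
apply: le_trans (ler_normD _ _).
rewrite le_eqVlt; apply/orP; left; apply/eqP; congr `|_|.
by rewrite /P !expr2 /=; field.
Qed.

Lemma jet_cexp0 : jet 3 (@cexp R).
Proof.
have [M hM] := cexp_taylor2.
pose psi w : R[i] := (cexp w - (1 + w + w ^+ 2 / 2)) / w ^+ 3.
apply: (@jetS _ _ 1 _ (fun w => 1 + w * (1 / 2 + w * psi w))).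
  move=> w; have [->|w0] := eqVneq w 0.
    by rewrite cexp0 mul0r addr0.
  by rewrite /psi; field.
apply: jetS (fun=> erefl) _; apply: jetS (fun=> erefl) _.
apply: (@jet0_bound _ _ M) => w w1; have [->|w0] := eqVneq w 0.
  rewrite /psi !expr0n /= invr0 mulr0 normr0.
  by have := hM 1; rewrite normr1 !expr1n mulr1 => /(_ (lexx _)); apply: le_trans.
by rewrite /psi normrM normfV normrX ler_pdivrMr ?exprn_gt0 ?normr_gt0 ?hM.
Qed.

Lemma jet_cexp (c z : R[i]) : jet 3 (fun w => cexp (c * (z + w))).
Proof.
have cexpE w : cexp (c * z) * cexp (c * w) = cexp (c * (z + w)).
  by rewrite mulrDr cexpD.
apply: jet_ext cexpE _; apply: jetM; first exact: jet_cst.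
exact: jet_scale jet_cexp0.
Qed.

End Cexp.

(** * A maximum modulus principle on squares *)

Section MaxMod.
Variable R : realType.
Local Open Scope complex_scope.
Implicit Types (x y a b : R) (z w : R[i]).

Lemma normc_sqrE z : normc z ^+ 2 = complex.Re z ^+ 2 + complex.Im z ^+ 2.
Proof. by case: z => a b; rewrite sqr_sqrtr // addr_ge0 ?sqr_ge0. Qed.

Lemma normc_ge0 z : 0 <= normc z.
Proof. by case: z => a b; exact: sqrtr_ge0. Qed.

Lemma normE z : `|z| = (normc z)%:C.
Proof. by []. Qed.

Lemma near0_ball (P : R[i] -> Prop) :
  (\forall w \near (0 : (R[i] : numFieldType)), P w) ->
  exists2 d : R, 0 < d & forall w, normc w < d -> P w.
Proof.
move=> /nbhs_ballP[d d0 dP].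
have /complex_realP[e de] : (d : R[i]) \is Num.real by exact: gtr0_real.
rewrite {}de in d0 dP.
have e0 : 0 < e by rewrite -ltcR.
exists e => // w we; apply: dP; rewrite -ball_normE /= sub0r normrN.
by rewrite -ltcR in we.
Qed.

Lemma jet3_expansion (f : R[i] -> R[i]) : jet 3 f ->
  exists (a b c : R[i]) (M d : R), [/\ 0 <= M, 0 < d & forall w, normc w < d ->
    exists2 e : R[i], f w = a + b * w + c * w ^+ 2 + e & normc e <= M * normc w ^+ 3].
Proof.
move=> /jetSP[a [g [/jetSP[b [h [/jetSP[c [k [[M kM] hE]]] gE]]] fE]]].
have [d1 d10 {}kM] := near0_ball kM.
have [d2 d20 {}hE] := near0_ball hE.
have [d3 d30 {}gE] := near0_ball gE.
have [d4 d40 {}fE] := near0_ball fE.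
have M0 : 0 <= M.
  by apply: le_trans (kM 0 _); rewrite ?normc0 ?normr_ge0.
exists a, b, c, (complex.Re M), (Num.min (Num.min d1 d2) (Num.min d3 d4)); split.
- by move: M0; rewrite lecE => /andP[].
- by rewrite !lt_min d10 d20 d30.
move=> w; rewrite !lt_min => /andP[/andP[w1 w2] /andP[w3 w4]].
exists (w ^+ 3 * k w).
  by rewrite fE // gE // hE //; ring.
have := kM w w1; rewrite normE lecE => /andP[_ /= kwM].
have nX n : normc (w ^+ n) = normc w ^+ n.
  by elim: n => [|n IH]; rewrite ?normc1 // !exprS normcM IH.
by rewrite normcM nX mulrC ler_wpM2r ?exprn_ge0 ?normc_ge0.
Qed.

Lemma sub_normc_sqr z w : normc z ^+ 2 - 2 * normc z * normc w <= normc (z + w) ^+ 2.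
Proof.
have : normc z <= normc (z + w) + normc w.
  by rewrite -(normcN w) -{1}(addrK w z) le_normcD.
have := normc_ge0 z; have := normc_ge0 w; have := normc_ge0 (z + w).
move: (normc _) (normc _) (normc _) => u v x.
have [xv|vx] := leP x v; nra.
Qed.

(** Averaging over the four directions kills all the cross terms, since the
    sums of [i^j] and of [i^(2 j)] over [j < 4] vanish. *)
Lemma mean_normc_sqr (a b c : R[i]) (s : R) :
  let q w := normc (a + b * w + c * w ^+ 2) ^+ 2 in
  q (s +i* 0) + q (0 +i* s) + q ((- s) +i* 0) + q (0 +i* (- s)) =
  4 * (normc a ^+ 2 + normc b ^+ 2 * s ^+ 2 + normc c ^+ 2 * (s ^+ 2) ^+ 2).
Proof.
rewrite /= !normc_sqrE.
by case: a b c => [a1 a2] [b1 b2] [c1 c2]; rewrite /= !expr2 /=; ring.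
Qed.

(** A discrete form of the subharmonicity of [|h|^2]: the average gain of
    [eps |z|^2] over the four points at distance [s] is [eps s^2], while the
    remainder of the expansion of [h] costs at most [2 L M s^3], where [L]
    bounds the quadratic polynomial for [s <= 1]. *)
Lemma no_strict_local_max (h : R[i] -> R[i]) z (eps d : R) :
  jet 3 (fun w => h (z + w)) -> 0 < eps -> 0 < d ->
  exists2 w, normc w < d &
    normc (h z) ^+ 2 + eps * normc z ^+ 2 <
    normc (h (z + w)) ^+ 2 + eps * normc (z + w) ^+ 2.
Proof.
move=> /jet3_expansion[a [b [c [M [d' [M0 d'0 hE]]]]]] eps0 d0.
pose L := normc a + normc b + normc c.
have L0 : 0 <= L by rewrite !addr_ge0 ?normc_ge0.
have LM0 : 0 < 2 * L * M + 1 by rewrite ltr_wpDl ?mulr_ge0.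
pose s := Num.min (Num.min (d / 2) (d' / 2)) (Num.min 1 (eps / (2 * L * M + 1) / 2)).
have s0 : 0 < s by rewrite !lt_min ltr01 !divr_gt0.
have [sd sd' s1 se] : [/\ s < d, s < d', s <= 1 & s * (2 * L * M + 1) < eps].
  rewrite -ltr_pdivlMr //.
  have h1 : s <= d / 2 by rewrite !ge_min lexx.
  have h2 : s <= d' / 2 by rewrite !ge_min lexx orbT.
  have h3 : s <= 1 by rewrite !ge_min lexx !orbT.
  have h4 : s <= eps / (2 * L * M + 1) / 2 by rewrite !ge_min lexx !orbT.
  have : 0 < eps / (2 * L * M + 1) by rewrite divr_gt0.
  by split; lra.
apply: contrapT => noW.
have a_h : h z = a.
  have := hE 0; rewrite normc0 addr0 => /(_ d'0)[e ->].
  rewrite expr0n mulr0 => e0; have /eq0_normc -> : normc e = 0.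
    by apply/eqP; rewrite eq_le e0 normc_ge0.
  by ring.
have bnd w : normc w = s -> normc (a + b * w + c * w ^+ 2) ^+ 2 - 2 * L * M * s ^+ 3
     + eps * normc (z + w) ^+ 2 <= normc a ^+ 2 + eps * normc z ^+ 2.
  move=> ws; have wd : normc w < d by rewrite ws.
  have /negP := (fun hw => noW (ex_intro2 _ _ w wd hw)).
  rewrite -leNgt a_h; apply: le_trans; rewrite lerD2r.
  have [|e -> he] := hE w; first by rewrite ws.
  apply: le_trans (sub_normc_sqr _ _); rewrite lerD2l lerN2 -!mulrA ler_pM2l //.
  rewrite ws in he; apply: ler_pM he; rewrite ?normc_ge0 //.
  apply: le_trans (le_normcD _ _) (lerD (le_trans (le_normcD _ _) _) _).
    rewrite lerD2l normcM ws -[leRHS]mulr1 ler_wpM2l ?normc_ge0 //.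
  rewrite expr2 !normcM ws -[leRHS]mulr1 ler_wpM2l ?normc_ge0 //.
  by rewrite -expr2 expr_le1 // ltW.
have N1 : normc (s +i* 0) = s by rewrite /= expr0n addr0 sqrtr_sqr gtr0_norm.
have N2 : normc (0 +i* s) = s by rewrite /= expr0n add0r sqrtr_sqr gtr0_norm.
have N3 : normc ((- s) +i* 0) = s.
  by rewrite /= expr0n addr0 sqrrN sqrtr_sqr gtr0_norm.
have N4 : normc (0 +i* (- s)) = s.
  by rewrite /= expr0n add0r sqrrN sqrtr_sqr gtr0_norm.
have := bnd _ N1; have := bnd _ N2; have := bnd _ N3; have := bnd _ N4.
have meanp := mean_normc_sqr a b c s; have meanz := mean_normc_sqr z 1 0 s.
cbv beta zeta in meanp, meanz; rewrite normc1 normc0 !mul1r !mul0r !addr0 in meanz.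
have lm0 : 0 <= L * M by rewrite mulr_ge0.
clear -se lm0 s0 s1 eps0 meanp meanz.
have s20 : 0 < s ^+ 2 by rewrite exprn_gt0.
have s21 : s ^+ 2 * (s * (2 * (L * M) + 1)) < s ^+ 2 * eps.
  by rewrite ltr_pM2l // mulrA.
have q1 := mulr_ge0 (sqr_ge0 (normc b)) (ltW s20).
have q2 := mulr_ge0 (sqr_ge0 (normc c)) (sqr_ge0 (s ^+ 2)).
have q3 := mulr_ge0 (sqr_ge0 s) (ltW s0).
have {}meanz := congr1 ( *%R eps) meanz.
rewrite expr1n expr0n /= in meanz.
lra.
Qed.

Lemma continuous_normc_jet (h : R[i] -> R[i]) (k : nat) (p : R * R) :
  jet k.+1 (fun w => h (p.1 +i* p.2 + w)) ->
  {for p, continuous (fun q : R * R => normc (h (q.1 +i* q.2)))}.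
Proof.
move=> hj; apply/cvgrPdist_lt => e e0.
have eC : 0 < e%:C by rewrite ltcR.
have [d d0 hd] := near0_ball (jet1_near hj eC).
have d20 : 0 < d / 2 by rewrite divr_gt0.
near=> q.
have pq1 : `|p.1 - q.1| < d / 2.
  by near: q; apply: cvgr_dist_lt => //; exact: cvg_fst.
have pq2 : `|p.2 - q.2| < d / 2.
  by near: q; apply: cvgr_dist_lt => //; exact: cvg_snd.
have : normc (q.1 +i* q.2 - p.1 +i* p.2) < d.
  rewrite -ltcR -normE; apply: le_lt_trans (normc_le_ReIm _) _; rewrite ltcR /=.
  by rewrite (splitr d) (distrC q.1) (distrC q.2) ltrD.
move=> /hd; rewrite addr0 (addrC (p.1 +i* p.2)) subrK normE ltcR; apply: le_lt_trans.
set u := h _; set v := h _.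
have := le_normcD (u - v) v; have := le_normcD (v - u) u.
rewrite !subrK -(opprB u) normcN ler_norml; lra.
Unshelve. all: by end_near. Qed.

Definition square (rho : R) : set (R * R) := (`[-rho, rho] `*` `[-rho, rho])%classic.

Lemma squareP rho a b : square rho (a, b) <-> `|a| <= rho /\ `|b| <= rho.
Proof.
by rewrite /square /= !in_itv /= -!ler_norml; split=> [[]|[]].
Qed.

Lemma compact_square rho : compact (square rho).
Proof. by apply: compact_setX; exact: segment_compact. Qed.

(** The term [eps |z|^2] is at most [2 eps rho^2] on the square; [eps] is taken
    small enough for a maximum of [|h|^2 + eps |z|^2] on the boundary to be
    below the value at 0. *)
Lemma max_modulus_square (h : R[i] -> R[i]) (rho M : R) : 0 < rho ->
  (forall a b, `|a| <= rho -> `|b| <= rho ->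
    jet 3 (fun w => h (a +i* b + w))) ->
  (forall a b, `|a| <= rho -> `|b| <= rho -> `|a| = rho \/ `|b| = rho ->
    normc (h (a +i* b)) <= M) ->
  normc (h 0) <= M.
Proof.
move=> rho0 hj hM; have [//|M_lt] := leP (normc (h 0)) M.
have M0 : 0 <= M.
  apply: le_trans (normc_ge0 _) (hM rho 0 _ _ _); rewrite ?normr0 ?gtr0_norm //.
  - exact: ltW.
  - by left.
pose eps := (normc (h 0) ^+ 2 - M ^+ 2) / (4 * rho ^+ 2).
have rho2 : 0 < rho ^+ 2 by rewrite exprn_gt0.
have eps0 : 0 < eps.
  by rewrite divr_gt0 ?mulr_gt0 // subr_gt0 ltrXn2r ?nnegrE ?normc_ge0.
have epsE : normc (h 0) ^+ 2 = M ^+ 2 + eps * (4 * rho ^+ 2).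
  by rewrite /eps; field; rewrite lt0r_neq0.
pose u (p : R * R) := normc (h (p.1 +i* p.2)) ^+ 2 + eps * (p.1 ^+ 2 + p.2 ^+ 2).
have [] := @compact_EVT_max _ R u (square rho) _ (@compact_square rho).
- by exists (0, 0); apply/squareP; rewrite normr0 ltW.
- apply: continuous_in_subspaceT => -[a b]; rewrite inE => /squareP[arho brho].
  rewrite /continuous_at /u; apply: cvgD.
    apply: cvgM; exact: (@continuous_normc_jet h 2 (a, b) (hj _ _ arho brho)).
  apply: cvgM; first exact: cvg_cst.
  by apply: cvgD; apply: cvgM; (exact: cvg_fst || exact: cvg_snd).
move=> [a b]; rewrite inE => /squareP[arho brho] umax.
have umax' a' b' : `|a'| <= rho -> `|b'| <= rho -> u (a', b') <= u (a, b).
  by move=> ra rb; apply: umax; rewrite inE; apply/squareP.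
have [a_lt b_lt] : `|a| < rho /\ `|b| < rho.
  have := umax' 0 0; rewrite normr0 /u /= => /(_ (ltW rho0) (ltW rho0)) ge0.
  have sq x : `|x| <= rho -> x ^+ 2 <= rho ^+ 2.
    by move=> xr; rewrite -real_normK ?num_real // lerXn2r ?nnegrE // ltW.
  have onbd : ~ (`|a| = rho \/ `|b| = rho).
    move=> /(hM _ _ arho brho) hab.
    have : normc (h (a +i* b)) ^+ 2 <= M ^+ 2 by rewrite lerXn2r ?nnegrE ?normc_ge0.
    have := sq _ arho; have := sq _ brho.
    move: ge0; rewrite epsE; nra.
  rewrite !lt_neqAle arho brho !andbT; split; apply/eqP => E; apply: onbd;
    by [left|right].
pose d := Num.min (rho - `|a|) (rho - `|b|).
have d0 : 0 < d by rewrite lt_min !subr_gt0 a_lt.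
have [w wd] := no_strict_local_max (hj _ _ arho brho) eps0 d0.
case: w wd => [w1 w2] wd; apply: contraLR => _; rewrite -leNgt.
move: wd; rewrite lt_min => /andP[wda wdb].
have w1n : `|w1| <= normc (w1 +i* w2) by have := normc_ge_Re (w1 +i* w2); rewrite lecR.
have w2n : `|w2| <= normc (w1 +i* w2) by have := normc_ge_Im (w1 +i* w2); rewrite lecR.
have -> : a +i* b + w1 +i* w2 = (a + w1) +i* (b + w2) by [].
rewrite !(normc_sqrE (_ +i* _)); apply: umax'.
  apply: le_trans (ler_normD _ _) _; lra.
apply: le_trans (ler_normD _ _) _; lra.
Qed.

(** Without a zero, [1 / f] would violate the maximum modulus principle; this
    takes the place of Rouche's theorem. *)
Lemma zero_in_square (f : R[i] -> R[i]) (z0 : R[i]) (rho delta : R) : 0 < rho ->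
  (forall a b, `|a| <= rho -> `|b| <= rho ->
    jet 3 (fun w => f (z0 + a +i* b + w))) ->
  (forall a b, `|a| <= rho -> `|b| <= rho -> `|a| = rho \/ `|b| = rho ->
    delta <= normc (f (z0 + a +i* b))) ->
  normc (f z0) < delta ->
  exists a b, [/\ `|a| <= rho, `|b| <= rho & f (z0 + a +i* b) = 0].
Proof.
move=> rho0 fj f_bd f0.
have delta0 : 0 < delta := le_lt_trans (normc_ge0 _) f0.
apply: contrapT => no_zero.
have f_neq0 a b : `|a| <= rho -> `|b| <= rho -> f (z0 + a +i* b) != 0.
  by move=> ar br; apply/eqP => fab; apply: no_zero; exists a, b.
have : normc ((f (z0 + 0))^-1) <= delta^-1.
  apply: (@max_modulus_square (fun w => (f (z0 + w))^-1) rho) => // a b ar br.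
    apply: (@jet_ext _ _ (fun w => (f (z0 + a +i* b + w))^-1)).
      by move=> w; rewrite addrA.
    by apply: jet_inv (fj a b ar br) _; rewrite addr0 f_neq0.
  move=> ab; have fab := f_bd _ _ ar br ab.
  by rewrite normcV lef_pV2 ?posrE // (lt_le_trans delta0).
apply/negP; rewrite -ltNge addr0 normcV ltf_pV2 ?posrE //.
have := f_neq0 0 0; rewrite normr0 (ltW rho0) addr0 => /(_ isT isT) fz0.
rewrite lt_neqAle normc_ge0 andbT eq_sym; apply: contra fz0.
by move=> /eqP/eq0_normc ->.
Qed.

Lemma boundary_lower_bound (g : R[i] -> R[i]) (rho : R) : 0 < rho ->
  (forall a b, `|a| <= rho -> `|b| <= rho ->
    jet 3 (fun w => g (a +i* b + w))) ->
  (forall a b, `|a| <= rho -> `|b| <= rho -> `|a| = rho \/ `|b| = rho ->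
    g (a +i* b) != 0) ->
  exists2 delta, 0 < delta & forall a b, `|a| <= rho -> `|b| <= rho ->
    `|a| = rho \/ `|b| = rho -> delta <= normc (g (a +i* b)).
Proof.
move=> rho0 gj g_neq0.
pose I := `[-rho, rho]%classic; pose E := [set rho; -rho]%classic.
have cE : compact E by apply: compactU; exact: compact_set1.
have cI : compact I by exact: segment_compact.
pose bd := (E `*` I `|` I `*` E)%classic.
have bdP a b : bd (a, b) <->
    [/\ `|a| <= rho, `|b| <= rho & `|a| = rho \/ `|b| = rho].
  have EP x : E x <-> `|x| = rho.
    split=> [[->|->]|/eqP]; [by rewrite gtr0_norm | by rewrite normrN gtr0_norm |].
    by rewrite eqr_norml => /andP[/orP[] /eqP -> _]; [left|right].
  have IP x : I x <-> `|x| <= rho by rewrite /I /= in_itv /= -ler_norml.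
  split=> [[[/EP aE /IP bI]|[/IP aI /EP bE]]|[/IP aI /IP bI [/EP|/EP] ?]].
  - by split; rewrite ?aE //; left.
  - by split; rewrite ?bE //; right.
  - by left.
  - by right.
have cbd : compact bd by apply: compactU; exact: compact_setX.
have rr : `|rho| = rho by rewrite gtr0_norm.
have [] := @compact_EVT_min _ R (fun p => normc (g (p.1 +i* p.2))) bd _ cbd.
- by exists (rho, rho); apply/bdP; split; rewrite ?rr //; left.
- apply: continuous_in_subspaceT => -[a b]; rewrite inE => /bdP[ar br _].
  exact: (@continuous_normc_jet g 2 (a, b) (gj _ _ ar br)).
move=> [a b]; rewrite inE => /bdP[ar br ab] gmin.
exists (normc (g (a +i* b))) => [|a' b' ar' br' ab']; last first.
  by apply: (gmin (a', b')); rewrite inE; apply/bdP.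
rewrite lt_neqAle normc_ge0 andbT eq_sym; apply: contra (g_neq0 _ _ ar br ab).
by move=> /eqP/eq0_normc ->.
Qed.

End MaxMod.

(** * Zeros of large modulus *)

Section DetLipschitz.
Variable F : numFieldType.

Lemma norm_prod_le (I : Type) (r : seq I) (x : I -> F) (L : F) :
  (forall i, `|x i| <= L) -> `|\prod_(i <- r) x i| <= L ^+ size r.
Proof.
move=> xL; elim: r => [|i r IH]; first by rewrite big_nil normr1.
by rewrite big_cons normrM exprS ler_pM.
Qed.

Lemma norm_prodB_le (I : Type) (r : seq I) (x y : I -> F) (L e : F) :
  1 <= L -> (forall i, `|x i| <= L) -> (forall i, `|y i| <= L) ->
  (forall i, `|x i - y i| <= e) ->
  `|\prod_(i <- r) x i - \prod_(i <- r) y i| <= (size r)%:R * L ^+ size r * e.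
Proof.
move=> L1 xL yL xy; have L0 : 0 <= L := le_trans ler01 L1.
elim: r => [|i r IH]; first by rewrite !big_nil subrr normr0 !mul0r.
have e0 : 0 <= e := le_trans (normr_ge0 _) (xy i).
rewrite !big_cons; set X := \prod_(j <- r) x j in IH *.
set Y := \prod_(j <- r) y j in IH *.
have -> : x i * X - y i * Y = (x i - y i) * X + y i * (X - Y) by ring.
apply: le_trans (ler_normD _ _) _; rewrite !normrM /=.
have -> : (size r).+1%:R * L ^+ (size r).+1 * e =
  e * L ^+ (size r).+1 + L * ((size r)%:R * L ^+ size r * e).
  by rewrite -natr1 exprS; ring.
apply: lerD; last exact: ler_pM.
apply: ler_pM => //; apply: le_trans (norm_prod_le _ xL) _.
by rewrite exprS ler_peMl ?exprn_ge0.
Qed.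

Lemma det_lipschitz n (L : F) : 1 <= L -> exists2 c : F, 0 <= c &
  forall (X Y : 'M[F]_n) (e : F),
    (forall i j, `|X i j| <= L) -> (forall i j, `|Y i j| <= L) ->
    (forall i j, `|X i j - Y i j| <= e) -> 0 <= e -> `|\det X - \det Y| <= c * e.
Proof.
move=> L1; have L0 : 0 <= L := le_trans ler01 L1.
exists (\sum_(s : 'S_n) n%:R * L ^+ n).
  by apply: sumr_ge0 => s _; rewrite mulr_ge0 ?exprn_ge0.
move=> X Y e XL YL XY e0; rewrite -sumrB mulr_suml.
apply: le_trans (ler_norm_sum _ _ _) _; apply: ler_sum => s _.
rewrite -mulrBr normrM normr_sign mul1r.
apply: le_trans (norm_prodB_le _ (x := fun i => X i (s i))
  (y := fun i => Y i (s i)) L1 _ _ _) _ => //.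
by rewrite /index_enum -enumT size_enum_ord.
Qed.

End DetLipschitz.

Section LargeZeros.
Variable R : realType.
Local Open Scope complex_scope.
Implicit Types (z w l : R[i]).

(** Hurwitz's principle along the translates [l0 + i k om] of a zero of [det N].
    On a square around [l0] the boundary values of [|det N|] are at least some
    [delta > 0]; on the [k]-th translate, where [|l| >= X], dividing by [l] makes
    the contribution of [E] to the determinant at most [c Lp / X < delta / 2]. *)
Lemma large_modulus_zero n (N E : R[i] -> 'M[R[i]]_n) (l0 : R[i])
    (om L rho0 : R) :
  (forall l i j, jet 3 (fun w => N (l + w) i j)) ->
  (forall l i j, jet 3 (fun w => E (l + w) i j)) ->
  (forall l i j, 0 <= complex.Re l -> normc (N l i j) <= L) ->
  (forall l i j, 0 <= complex.Re l -> normc (E l i j) <= L) ->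
  0 < om -> (forall l, N (l + om*i) = N l) ->
  0 < complex.Re l0 -> \det (N l0) = 0 ->
  0 < rho0 -> (forall z, z != 0 -> normc z < rho0 -> \det (N (l0 + z)) != 0) ->
  exists2 l, \det (l *: N l - E l) = 0 & 0 < complex.Re l.
Proof.
move=> Nj Ej NL EL om0 Nper Rel0 detN0 rho00 isol.
pose rho := Num.min (complex.Re l0 / 2) (rho0 / 4).
have rho_gt0 : 0 < rho by rewrite lt_min !divr_gt0.
have rhoR : rho < complex.Re l0.
  by rewrite /rho gt_min; apply/orP; left; lra.
have rhorho0 : rho + rho < rho0.
  have : rho <= rho0 / 4 by rewrite ge_min lexx orbT.
  lra.
have norm_sq (a b : R) : `|a| <= rho -> `|b| <= rho -> normc (a +i* b) < rho0.
  move=> ar br; rewrite -ltcR -normE; apply: le_lt_trans (normc_le_ReIm _) _.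
  by rewrite ltcR; apply: le_lt_trans rhorho0; exact: lerD.
have [delta delta0 hdelta] : exists2 delta : R, 0 < delta & forall a b : R,
    `|a| <= rho -> `|b| <= rho -> `|a| = rho \/ `|b| = rho ->
    delta <= normc (\det (N (l0 + (a +i* b)))).
  apply: (@boundary_lower_bound _ (fun z => \det (N (l0 + z)))) => // a b ar br.
    apply: jet_det => i j; apply: jet_ext (Nj (l0 + (a +i* b)) i j) => w.
    by rewrite addrA.
  move=> ab; apply: isol; last exact: norm_sq.
  apply/eqP => -[a0 b0]; case: ab; rewrite ?a0 ?b0 normr0 => r0;
  by move: rho_gt0; rewrite -r0 ltxx.
have L0 : 0 <= `|L| by [].
(* [Lp] bounds the entries of [N l] and of [N l - E l / l] for [|l| >= 1]
   in the right half-plane. *)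
pose Lp := 2 * `|L| + 1.
have Lp1 : 1 <= Lp by rewrite lerDr mulr_ge0.
have [|C C0 hC] := @det_lipschitz (R[i] : numFieldType) n Lp%:C.
  by rewrite -lecR in Lp1.
have /complex_realP[c cE] : (C : R[i]) \is Num.real by exact: ger0_real.
rewrite {}cE in C0 hC.
have c0 : 0 <= c by rewrite -lecR.
pose X := 1 + 2 * c * Lp / delta.
have X1 : 1 <= X.
  by rewrite lerDl divr_ge0 ?(ltW delta0) // !mulr_ge0 // (le_trans ler01).
have X0 : 0 < X by exact: lt_le_trans ltr01 X1.
pose k := Num.bound ((X + `|complex.Im l0| + rho) / om).
have kP : X + `|complex.Im l0| + rho < om * k%:R.
  rewrite mulrC -ltr_pdivrMr //; apply: archi_boundP.
  apply: divr_ge0 (ltW om0); apply: addr_ge0 (ltW rho_gt0).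
  exact: addr_ge0 (ltW X0) (normr_ge0 _).
pose z0 := l0 + (om * k%:R)*i.
have NperK l j : N (l + (om * j%:R)*i) = N l.
  elim: j => [|j IH]; first by rewrite mulr0 addr0.
  rewrite -[RHS]IH -[RHS]Nper; congr N; rewrite -addrA; congr (_ + _).
  by rewrite -natr1 mulrDr mulr1; congr (_ +i* _); rewrite addr0.
have in_sq a b : `|a| <= rho -> `|b| <= rho ->
    0 < complex.Re (z0 + a +i* b) /\ X <= normc (z0 + a +i* b).
  move=> ar br; split.
    rewrite /z0; case: (l0) rhoR => x y /= xr.
    by move: ar; rewrite ler_norml; lra.
  rewrite -lecR -normE; apply: le_trans (normc_ge_Im _); rewrite lecR.
  rewrite /z0; case: (l0) kP => x y /= kP.
  apply: le_trans (ler_norm _); move: br; rewrite ler_norml.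
  have := ler_norm (- y); rewrite normrN; lra.
(* Dividing by [l] does not change the zeros and brings [f] close to [det N]. *)
pose f l := \det (N l - l^-1 *: E l).
have close a b : `|a| <= rho -> `|b| <= rho ->
    normc (f (z0 + a +i* b) - \det (N (l0 + a +i* b))) < delta / 2.
  move=> ar br; have [/ltW Re0 Xl] := in_sq _ _ ar br.
  set l := z0 + _ in Re0 Xl *.
  have -> : N (l0 + a +i* b) = N l.
    by rewrite -(NperK _ k); congr N; rewrite /l /z0 addrAC.
  have linvE i j : normc (l^-1 * E l i j) <= `|L| / X.
    rewrite normcM normcV mulrC.
    apply: ler_pM; rewrite ?normc_ge0 ?invr_ge0 ?normc_ge0 //.
      by apply: le_trans (EL _ _ _ Re0) _; exact: ler_norm.
    by rewrite lef_pV2 ?posrE // (lt_le_trans X0).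
  have NlL i j : normc (N l i j) <= `|L|.
    by apply: le_trans (NL _ _ _ Re0) _; exact: ler_norm.
  have LX : `|L| / X <= `|L| by rewrite ler_pdivrMr // ler_peMr.
  have LXp : `|L| / X <= Lp / X.
    by rewrite ler_pM2r ?invr_gt0 // /Lp; lra.
  apply: (@le_lt_trans _ _ (c * (Lp / X))); last first.
    rewrite mulrA ltr_pdivrMr //.
    have -> : delta / 2 * X = delta / 2 + c * Lp.
      by rewrite /X; field; rewrite lt0r_neq0.
    by rewrite ltrDr divr_gt0.
  rewrite -lecR rmorphM -normE; apply: hC.
  - move=> i j; rewrite !mxE normE lecR.
    apply: le_trans (le_normcD _ _) _; rewrite normcN.
    have := linvE i j; have := NlL i j; rewrite /Lp; lra.
  - move=> i j; rewrite normE lecR; have := NlL i j; rewrite /Lp; lra.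
  - move=> i j; rewrite !mxE normE lecR addrAC subrr add0r normcN.
    exact: le_trans (linvE _ _) LXp.
  by rewrite ler0c divr_ge0 // ltW // (lt_le_trans ltr01).
have [|||a [b [ar br fl]]] := @zero_in_square R f z0 rho (delta / 2) rho_gt0.
- move=> a b ar br; apply: jet_det => i j.
  apply: (@jet_ext _ _ (fun w => N (z0 + a +i* b + w) i j +
     (- 1) * ((z0 + a +i* b + w)^-1 * E (z0 + a +i* b + w) i j))).
    by move=> w; rewrite !mxE mulN1r.
  apply: jetD (Nj _ _ _) (jetM (jet_cst _ _) (jetM _ (Ej _ _ _))).
  apply: jet_inv; first by apply: jetD; [exact: jet_cst | exact: jet_id].
  rewrite addr0; apply/eqP => z00; have [+ _] := in_sq _ _ ar br.
  by rewrite z00 /= ltxx.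
- move=> a b ar br ab; have := hdelta _ _ ar br ab; have := close _ _ ar br.
  set u := \det _; set v := f _; have := le_normcD (u - v) v.
  rewrite subrK -opprB normcN; lra.
- have := close 0 0; rewrite normr0 => /(_ (ltW rho_gt0) (ltW rho_gt0)).
  by rewrite !addr0 detN0 subr0.
have [Rel _] := in_sq _ _ ar br; set l := z0 + _ in Rel fl.
exists l => //; have l_neq0 : l != 0.
  by apply/eqP => l0'; move: Rel; rewrite l0' ltxx.
have -> : l *: N l - E l = l *: (N l - l^-1 *: E l).
  by rewrite scalerBr scalerA divff // scale1r.
by rewrite detZ -/(f l) fl mulr0.
Qed.

End LargeZeros.

(** * Roots of the neutral part *)

Section Spectral.
Variable R : realType.
Local Open Scope complex_scope.
Implicit Types (z w l mu : R[i]).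

(** The spectrum cannot be empty here, as the supremum of the empty set is 0. *)
Lemma spectral_radius_gt1 n (M : 'M[R]_n) : 1 < spectral_radius M ->
  exists2 mu, eigenvalue (cplx_mx M) mu & 1 < normc mu.
Proof.
rewrite /spectral_radius; set S := (X in sup X) => S1.
have S0 : (S !=set0)%classic.
  by apply/set0P/eqP => S0; move: S1; rewrite S0 sup0 ltr10.
by have [_ [mu mu_eig <-] mu1] := sup_gt S0 S1; exists mu.
Qed.

Lemma eigenvalue_det n (M : 'M[R[i]]_n) mu :
  eigenvalue M mu = (\det (mu%:M - M) == 0).
Proof.
rewrite /eigenvalue /eigenspace kermx_eq0 row_free_unit unitmxE unitfE negbK.
by rewrite -opprB -scaleN1r detZ mulf_eq0 signr_eq0.
Qed.

Lemma isolated_root (p : {poly R[i]}) mu : p != 0 ->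
  exists2 eta : R, 0 < eta &
    forall z, z != mu -> normc (z - mu) < eta -> ~~ root p z.
Proof.
move=> p0; have [rs ->] := closed_field_poly_normal p.
have [eta eta0 hrs] : exists2 eta : R, 0 < eta & forall z, z \in rs -> z != mu ->
    eta <= normc (z - mu).
  elim: rs => [|x rs [eta eta0 IH]]; first by exists 1.
  have [->|xmu] := eqVneq x mu.
    by exists eta => // z; rewrite inE => /orP[/eqP ->|/IH //]; rewrite eqxx.
  have xmu0 : 0 < normc (x - mu).
    rewrite lt_neqAle normc_ge0 andbT eq_sym; apply: contra xmu.
    by move=> /eqP/eq0_normc/eqP; rewrite subr_eq0.
  exists (Num.min eta (normc (x - mu))); first by rewrite lt_min eta0.
  move=> z; rewrite inE => /orP[/eqP -> _|zrs zmu]; first by rewrite ge_min lexx orbT.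
  by rewrite ge_min IH.
exists eta => // z zmu zeta; rewrite rootZ ?lead_coef_eq0 // root_prod_XsubC.
by apply/negP => /hrs /(_ zmu); rewrite leNgt zeta.
Qed.

Lemma cexp_surj mu : mu != 0 -> exists2 z, cexp z = mu & complex.Re z = ln (normc mu).
Proof.
move=> mu0; have rho0 : 0 < normc mu.
  rewrite lt_neqAle normc_ge0 andbT eq_sym; apply: contra mu0.
  by move=> /eqP/eq0_normc ->.
have := normc_sqrE mu; move: (normc mu) rho0 => rho rho0.
case: mu {mu0} => a b rhoE.
rewrite [complex.Re _]/= [complex.Im _]/= in rhoE.
have nr : rho != 0 by rewrite lt0r_neq0.
have xy : (a / rho) ^+ 2 + (b / rho) ^+ 2 = 1.
  by rewrite !exprMn -mulrDl -rhoE -exprMn divff // expr1n.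
have x1 : -1 <= a / rho <= 1.
  rewrite -ler_norml -(ler_pXn2r (ltn0Sn 1)) ?nnegrE // expr1n.
  by rewrite real_normK ?num_real // -xy lerDl sqr_ge0.
have cosE : cos (acos (a / rho)) = a / rho by rewrite acosK // in_itv.
have sinE : sin (acos (a / rho)) = `|b / rho|.
  by rewrite sin_acos // -xy addrAC subrr add0r sqrtr_sqr.
have [t ct st] : exists2 t, cos t = a / rho & sin t = b / rho.
  have [b0|b0] := leP 0 (b / rho).
    by exists (acos (a / rho)); rewrite ?sinE ?ger0_norm.
  by exists (- acos (a / rho)); rewrite ?cosN ?sinN ?sinE ?ltr0_norm ?opprK.
exists (ln rho +i* t); last exact: erefl.
rewrite /cexp lnK ?posrE // ct st.
by congr (_ +i* _); rewrite mulrCA divff ?mulr1.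
Qed.

(** Local injectivity of the exponential: [|w| < 1 < pi] excludes the nonzero
    multiples of [2 i pi]. *)
Lemma cexp_eq1_near0 : exists2 d : R, 0 < d &
  forall w, normc w < d -> cexp w = 1 -> w = 0.
Proof.
exists 1 => // -[a b] ab1 E.
have b1 : `|b| < 1.
  by apply: le_lt_trans ab1; rewrite -lecR -normE (normc_ge_Im (a +i* b)).
have a0 : a = 0.
  have := normc_cexp (a +i* b); rewrite E normr1 -[1 in LHS]/(1%:C).
  move=> /complexI /esym expa; apply: expR_inj.
  rewrite expR0.
  exact: expa.
have sb : sin b = 0.
  move: E; rewrite a0 /cexp expR0 !mul1r -[1]/(1%:C) => /eqP.
  by rewrite eq_complex => /andP[_ /eqP].
have b2 : `|b| < pi.
  by apply: lt_trans b1 _; apply: lt_le_trans (pi_ge2 R); rewrite ltr1n.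
rewrite a0; have [b0|b0|->] := ltgtP b 0.
- rewrite ltr0_norm // in b2.
  have := @sin_gt0_pi R (- b); rewrite oppr_gt0 b0 b2 sinN sb oppr0 ltxx.
  by move=> /(_ isT).
- rewrite gtr0_norm // in b2.
  by have := @sin_gt0_pi R b; rewrite b0 b2 sb ltxx => /(_ isT).
by [].
Qed.

End Spectral.

Section Assembly.
Variable R : realType.
Local Open Scope complex_scope.
Implicit Types (z w l mu : R[i]).

(** A crude bound on all the entries at once, which is enough to control the
    coefficient matrices. *)
Definition mx_bound {m n} (M : 'M[R[i]]_(m, n)) : R := \sum_i \sum_j normc (M i j).

Lemma mx_bound_ge0 m n (M : 'M[R[i]]_(m, n)) : 0 <= mx_bound M.
Proof. by apply: sumr_ge0 => i _; apply: sumr_ge0 => j _; exact: normc_ge0. Qed.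

Lemma normc_le_mx_bound m n (M : 'M[R[i]]_(m, n)) i j : normc (M i j) <= mx_bound M.
Proof.
rewrite /mx_bound (bigD1 i) //= (bigD1 j) //= -addrA lerDl addr_ge0 //.
  by apply: sumr_ge0 => j' _; exact: normc_ge0.
by apply: sumr_ge0 => i' _; apply: sumr_ge0 => j' _; exact: normc_ge0.
Qed.

Lemma normc_sum (I : Type) (r : seq I) (P : pred I) (F : I -> R[i]) :
  normc (\sum_(i <- r | P i) F i) <= \sum_(i <- r | P i) normc (F i).
Proof.
elim/big_rec2: _ => [|i y x _ xy]; first by rewrite normc0.
by apply: le_trans (le_normcD _ _) _; rewrite lerD2l.
Qed.

Lemma normc_delay_le1 l (t : R) : 0 <= complex.Re l -> 0 <= t ->
  normc (cexp (- l * t%:C)) <= 1.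
Proof.
move=> l0 t0; rewrite -lecR -normE normc_cexp lecR -expR0 ler_expR.
by case: l l0 => a b /= a0; rewrite mulr0 subr0 mulNr oppr_le0 mulr_ge0.
Qed.

Lemma normc_delayM_le l (t : R) (x : R[i]) : 0 <= complex.Re l -> 0 <= t ->
  normc (cexp (- l * t%:C) * x) <= normc x.
Proof.
by move=> l0 t0; rewrite normcM ler_piMl ?normc_ge0 // normc_delay_le1.
Qed.

Lemma jet_delay l (t : R) : jet 3 (fun w => cexp (- (l + w) * t%:C)).
Proof.
apply: jet_ext (jet_cexp (- t%:C) l) => w; congr cexp.
by rewrite !mulNr mulrC.
Qed.

Lemma cexp_2pi : cexp ((pi *+ 2)*i) = 1 :> R[i].
Proof. by rewrite /cexp cos2pi sin2pi expR0 mul1r mulr0. Qed.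

Lemma cexp_neq0 z : cexp z != 0.
Proof.
apply/eqP => c0; have := cexpD z (- z); rewrite c0 mul0r subrr cexp0 => /eqP.
by rewrite oner_eq0.
Qed.

Lemma cexpN z : cexp (- z) = (cexp z)^-1.
Proof.
by apply: (mulfI (cexp_neq0 z)); rewrite -cexpD subrr cexp0 divff ?cexp_neq0.
Qed.

Lemma delay_periodic (r : R) l : 0 < r ->
  cexp (- (l + (pi *+ 2 / r)*i) * r%:C) = cexp (- l * r%:C).
Proof.
move=> r0.
have turn : (pi *+ 2 / r)*i * r%:C = (pi *+ 2)*i.
  apply/eqP; rewrite eq_complex /= !mul0r mulr0 subrr mulfVK ?lt0r_neq0 //.
  by rewrite add0r !eqxx.
by rewrite opprD mulrDl cexpD (mulNr _*i) turn cexpN cexp_2pi invr1 mulr1.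
Qed.

(** The coefficient of [l] in the characteristic matrix of a neutral equation. *)
Definition neutral_part n (D : 'M[R[i]]_n) (r : R) (l : R[i]) : 'M[R[i]]_n :=
  1%:M - cexp (- l * r%:C) *: D.

(** Factoring out [e^(- l r)] leaves the characteristic matrix of [D]. *)
Lemma det_neutral_part n (D : 'M[R[i]]_n) (r : R) l :
  (\det (neutral_part D r l) == 0) = eigenvalue D (cexp (l * r%:C)).
Proof.
rewrite eigenvalue_det.
have -> : neutral_part D r l = cexp (- l * r%:C) *: ((cexp (l * r%:C))%:M - D).
  by rewrite scalerBr scale_scalar_mx -cexpD -mulrDl addNr mul0r cexp0.
by rewrite detZ mulf_eq0 expf_eq0 (negPf (cexp_neq0 _)) andbF.
Qed.

(** The zero is isolated because [mu] is an isolated root of the characteristic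
    polynomial of [D] and [z |-> mu e^(z r)] takes the value [mu] only at 0
    near 0. *)
Lemma neutral_root n (D : 'M[R[i]]_n) (r : R) mu : 0 < r -> eigenvalue D mu ->
  1 < normc mu -> exists l0 (rho0 : R), [/\ 0 < complex.Re l0, 0 < rho0,
    \det (neutral_part D r l0) = 0 &
    forall z, z != 0 -> normc z < rho0 -> \det (neutral_part D r (l0 + z)) != 0].
Proof.
move=> r0 Dmu mu1.
have mu0 : mu != 0 by apply/eqP => E; move: mu1; rewrite E normc0 ltr10.
have nmu0 : 0 < normc mu := lt_trans ltr01 mu1.
have [z0 z0E Rez0] := cexp_surj mu0.
pose l0 := z0 / r%:C.
have rC : r%:C != 0 by rewrite fmorph_eq0 lt0r_neq0.
have l0r : l0 * r%:C = z0 by rewrite mulfVK.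
have char0 : char_poly D != 0 by rewrite monic_neq0 ?char_poly_monic.
have [eta eta0 isol] := isolated_root mu char0.
have [d1 d10 hd1] := cexp_eq1_near0 R.
have eC : 0 < (eta / normc mu)%:C by rewrite ltcR divr_gt0.
have [d2 d20 hd2] := near0_ball (jet1_near (jet_cexp0 R) eC).
exists l0, (Num.min d1 d2 / r); split.
- have : complex.Re (l0 * r%:C) = complex.Re l0 * r.
    by case: (l0) => a b /=; rewrite mulr0 subr0.
  by rewrite l0r Rez0 => E; rewrite -(pmulr_lgt0 _ r0) -E ln_gt0.
- by rewrite divr_gt0 // lt_min d10.
- by apply/eqP; rewrite det_neutral_part l0r z0E.
move=> z z_neq0; rewrite ltr_pdivlMr // => zr.
have nzr : normc (z * r%:C) = normc z * r.
  by rewrite normcM /= expr0n addr0 sqrtr_sqr gtr0_norm.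
rewrite -nzr lt_min in zr; have /andP[z1 z2] := zr.
rewrite det_neutral_part mulrDl l0r cexpD z0E eigenvalue_root_char.
apply: isol.
  apply/eqP => E; have /hd1 /eqP : cexp (z * r%:C) = 1.
    by apply: (mulfI mu0); rewrite E mulr1.
  by move=> /(_ z1); rewrite mulf_eq0 (negPf z_neq0) (negPf rC).
rewrite -[X in _ - X](mulr1 mu) -mulrBr normcM.
rewrite mulrC -ltr_pdivlMr //.
by have := hd2 _ z2; rewrite cexp0 normE ltcR.
Qed.

End Assembly.

(** * Instability for every input delay *)

Theorem proposition3p1 (R : realType) (n m p K q : nat)
    (A0 : 'M[R]_n) (A : 'I_K -> 'M[R]_n) (tau : 'I_K -> R)
    (B : 'M[R]_(n, m)) (C : 'M[R]_(p, n))
    (tau_gt0 : forall k : 'I_K, 0 < tau k)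
    (tau_incr : forall k l : 'I_K, (k < l)%N -> tau k < tau l)
    (rankB : \rank B = m) (rankC : \rank C = p)
    (Kp Kd Ki : 'M[R]_(m, p))
    (rankKi : q = \rank Ki)
    (Ui : 'M[R]_(m, q)) (Vi : 'M[R]_(q, p))
    (rankUi : \rank Ui = q) (rankVi : \rank Vi = q)
    (KiE : Ki = Ui *m Vi)
    (stable0 : exponentially_stable (nominal_charfun A0 A tau B C Kp Kd Ui Vi))
    (rho_gt1 : 1 < spectral_radius (B *m Kd *m C)) :
  forall r : R, 0 < r ->
    unstable (input_delay_charfun A0 A tau B C Kp Kd Ui Vi r).
Proof.
move=> r r0.
have [mu mu_eig mu1] := spectral_radius_gt1 rho_gt1.
have [l0 [rho0 [Rel0 rho00 det0 isol]]] := neutral_root r0 mu_eig mu1.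
pose D := cplx_mx (block_mx (B *m Kd *m C) 0 0 (0 : 'M[R]_q)).
pose E0 : 'M[R[i]]_(n + q) := cplx_mx (block_mx A0 0 (Vi *m C) 0).
pose E1 : 'M[R[i]]_(n + q) := cplx_mx (block_mx (B *m Kp *m C) (B *m Ui) 0 0).
pose Ek k : 'M[R[i]]_(n + q) := cplx_mx (block_mx (A k) 0 0 0).
pose N := neutral_part D r.
pose E (l : R[i]) := E0 + cexp (- l * (r%:C)%C) *: E1
   + \sum_(k < K) cexp (- l * ((tau k)%:C)%C) *: Ek k.
(* The integrator block of [N] is the identity and does not affect the
   determinant. *)
have detN l : \det (N l) = \det (neutral_part (cplx_mx (B *m Kd *m C)) r l).
  rewrite /N /neutral_part /D /cplx_mx map_block_mx !map_mx0 scalar_mx_block.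
  rewrite scale_block_mx opp_block_mx add_block_mx !scaler0 !subr0.
  by rewrite det_ublock det1 mulr1.
have HE l : input_delay_charfun A0 A tau B C Kp Kd Ui Vi r l = \det (l *: N l - E l).
  rewrite /input_delay_charfun; congr (\det _).
  by rewrite -scalar_mx_block /cplx_mx map_mx1 /N /neutral_part /E !opprD !addrA.
pose bound := mx_bound (1%:M : 'M[R[i]]_(n + q)) + mx_bound D
   + mx_bound E0 + mx_bound E1 + \sum_k mx_bound (Ek k).
have b1 := mx_bound_ge0 (1%:M : 'M[R[i]]_(n + q)).
have b2 := mx_bound_ge0 D.
have b3 := mx_bound_ge0 E0.
have b4 := mx_bound_ge0 E1.
have b5 : 0 <= \sum_k mx_bound (Ek k).
  by apply: sumr_ge0 => k _; exact: mx_bound_ge0.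
have NE l i j : N l i j = (1%:M : 'M[R[i]]_(n + q)) i j - cexp (- l * (r%:C)%C) * D i j.
  by rewrite mxE; congr (_ + _); rewrite mxE; congr (- _); rewrite mxE.
have EE l i j : E l i j = E0 i j + cexp (- l * (r%:C)%C) * E1 i j
    + \sum_k cexp (- l * ((tau k)%:C)%C) * Ek k i j.
  rewrite mxE; congr (_ + _).
    by rewrite mxE; congr (_ + _); rewrite mxE.
  by rewrite summxE; apply: eq_bigr => k _; rewrite mxE.
have NL l i j : 0 <= complex.Re l -> normc (N l i j) <= bound.
  move=> l_ge0; rewrite NE.
  apply: (@le_trans _ _ (mx_bound (1%:M : 'M[R[i]]_(n + q)) + mx_bound D)); last first.
    by rewrite /bound; lra.
  apply: le_trans (le_normcD _ _) _; rewrite normcN; apply: lerD.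
    exact: normc_le_mx_bound.
  exact: le_trans (normc_delayM_le _ l_ge0 (ltW r0)) (normc_le_mx_bound _ _ _).
have EL l i j : 0 <= complex.Re l -> normc (E l i j) <= bound.
  move=> l_ge0; rewrite EE.
  apply: (@le_trans _ _ (mx_bound E0 + mx_bound E1 + \sum_k mx_bound (Ek k))); last first.
    by rewrite /bound; lra.
  apply: le_trans (le_normcD _ _) _; apply: lerD.
    apply: le_trans (le_normcD _ _) _; apply: lerD.
      exact: normc_le_mx_bound.
    exact: le_trans (normc_delayM_le _ l_ge0 (ltW r0)) (normc_le_mx_bound _ _ _).
  apply: le_trans (normc_sum _ _ _) _; apply: ler_sum => k _.
  exact: le_trans (normc_delayM_le _ l_ge0 (ltW (tau_gt0 k))) (normc_le_mx_bound _ _ _).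
have Nj l i j : jet 3 (fun w => N (l + w) i j).
  apply: (@jet_ext _ _ (fun w => (1%:M : 'M[R[i]]_(n + q)) i j
     + (- D i j) * cexp (- (l + w) * (r%:C)%C))).
    by move=> w; rewrite NE mulNr mulrC.
  apply: jetD (jet_cst _ _) (jetM (jet_cst _ _) _); exact: jet_delay.
have Ej l i j : jet 3 (fun w => E (l + w) i j).
  apply: jet_ext (fun w => esym (EE (l + w) i j)) _.
  apply: jetD; first apply: jetD; first exact: jet_cst.
    by apply: jetM; [exact: jet_delay | exact: jet_cst].
  by apply: jet_sum => k; apply: jetM; [exact: jet_delay | exact: jet_cst].
have om0 : 0 < pi *+ 2 / r :> R by rewrite divr_gt0 // -mulr_natl mulr_gt0 ?pi_gt0.
have [|||l Hl Rel] := @large_modulus_zero R _ N E l0 (pi *+ 2 / r) bound rho0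
    Nj Ej NL EL om0 _ Rel0 _ rho00 _.
- by move=> l; rewrite /N /neutral_part delay_periodic.
- by rewrite detN.
- by move=> z z0 zr; rewrite detN isol.
by exists l => //; rewrite HE.
Qed.
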